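(* The morphisms $R_{\mathcal V_1,\mathcal V_2,\mathcal V_3,\mathcal V_4}:(\mathcal V_1\boxtimes\mathcal V_2)\ominus(\mathcal V_3\boxtimes\mathcal V_4)\to(\mathcal V_1\ominus\mathcal V_3)\boxtimes(\mathcal V_2\ominus\mathcal V_4)$, for $\mathcal V_1,\dots,\mathcal V_4$ linear $\mathsf{TW}$-indexed collections, form a natural transformation $$R:\ \ominus\circ(\boxtimes\times\boxtimes)\longrightarrow\boxtimes\circ(\ominus\times\ominus)\circ\tau_{2,3},$$ $\tau_{2,3}(\mathcal V_1,\mathcal V_2,\mathcal V_3,\mathcal V_4)=(\mathcal V_1,\mathcal V_3,\mathcal V_2,\mathcal V_4)$, which satisfies the following two associativity constraints for all linear $\mathsf{TW}$-indexed collections $A,B,C,D,E,F$ (subscripts of $R$ omitted; $\alpha^\ominus,\alpha^\boxtimes$ denote the associators of $\ominus,\boxtimes$). (1) As morphisms $((A\boxtimes B)\ominus(C\boxtimes D))\ominus(E\boxtimes F)\to(A\ominus(C\ominus E))\boxtimes(B\ominus(D\ominus F))$, $$(\alpha^\ominus\boxtimes\alpha^\ominus)\circ R\circ(R\ominus\mathrm{id})=R\circ(\mathrm{id}\ominus R)\circ\alpha^\ominus.$$ (2) As morphisms $((A\boxtimes B)\boxtimes C)\ominus((D\boxtimes E)\boxtimes F)\to(A\ominus D)\boxtimes((B\ominus E)\boxtimes(C\ominus F))$, $$\alpha^\boxtimes\circ(R\boxtimes\mathrm{id})\circ R=(\mathrm{id}\boxtimes R)\circ R\circ(\alpha^\b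oxtimes\ominus\alpha^\boxtimes).$$
   Context: Write $\llbracket n\rrbracket=\{1,\dots,n\}$. For a word $w$ of length $|w|$ and $A=\{i_1<\dots<i_p\}\subset\llbracket|w|\rrbracket$, $w|_A=w(i_1)\cdots w(i_p)$. Translucent words. A translucent word is a pair $t=(\alpha_t,b_t)$ of words of equal length $|t|\ge0$, $\alpha_t\in\{\mathsf L,\mathsf R\}^\star$, $b_t\in\{0,1\}^\star$; $\mathsf{TW}$ is the set of translucent words. Put $[t]_0=\{i:b_t(i)=0\}$, $[t]_1=\{i:b_t(i)=1\}$, $t(i)=(\alpha_t(i),b_t(i))$, $t|_A=(\alpha_t|_A,b_t|_A)$. $\mathrm{source}(t)=\alpha_t$, $\mathrm{target}(t)=\alpha_t|_{[t]_0}$. If $\mathrm{source}(r)=\mathrm{target}(s)$ ($r,s$ composable), $r\circ s$ is the unique translucent word $t$ of length $|s|$ with $t|_{[s]_1}=s|_{[s]_1}$ and $t|_{[s]_0}=r$. The necklace order $\lessdot$ on $\llbracket|t|\rrbracket$ is the total order in which all $\mathsf L$-positions (those with $\alpha_t(i)=\mathsf L$) precede all $\mathsf R$-positions, the $\mathsf L$-positions being ordered increasingly and the $\mathsf R$-positions decreasingly. For $i\in[t]_0$, $t^{\lessdot i}=t|_{\{j:\,j\lessdot i\}}$ and $t^{\gtrdot i}=t|_{\{j:\,i\lessdot j\}}$. Collections. A linear $\mathsf{TW}$-indexed collection is a family $\mathcal V=(\mathcal V(t))_{t\in\mathsf{TW}}$ of complex vector spaces; morphisms are families of linear maps. The vertical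 and horizontal compositions are $$(\mathcal V\boxtimes\mathcal V')(t)=\bigoplus_{t=r\circ s}\mathcal V(r)\otimes\mathcal V'(s),\qquad(\mathcal V\ominus\mathcal V')(t)=\bigoplus_{i\in[t]_0}\mathcal V(t^{\lessdot i})\otimes\mathcal V'(t^{\gtrdot i}),$$ with the obvious action on morphisms and the associators $\alpha^\boxtimes,\alpha^\ominus$ induced by the trivial rebracketing $(u\otimes v)\otimes w\mapsto u\otimes(v\otimes w)$. Definition of $R$. The component at $t$ of $(\mathcal V_1\boxtimes\mathcal V_2)\ominus(\mathcal V_3\boxtimes\mathcal V_4)$ is the direct sum, over all $i\in[t]_0$ and composable pairs $(r_-,s_-)$, $(r_+,s_+)$ with $r_-\circ s_-=t^{\lessdot i}$, $r_+\circ s_+=t^{\gtrdot i}$, of $(\mathcal V_1(r_-)\otimes\mathcal V_2(s_-))\otimes(\mathcal V_3(r_+)\otimes\mathcal V_4(s_+))$. Given such data, let $s$ be the unique translucent word of length $|t|$ with left-right word $\alpha_s=\alpha_t$, $s^{\lessdot i}=s_-$, $s^{\gtrdot i}=s_+$ and $s(i)=t(i)$; let $r=t|_{[s]_0}$; and let $i'$ be the rank of $i$ in $[s]_0$ for the natural order. Then $r\circ s=t$, $r^{\lessdot i'}=r_-$, $r^{\gtrdot i'}=r_+$. On this summand $R$ is the map $$(a\otimes b)\otimes(c\otimes d)\mapsto(a\otimes c)\otimes(b\otimes d)\in\big(\mathcal V_1(r^{\lessdot i'})\otimes\mathcal V_3(r^{\gtrdot i'})\big)\otimes\big(\mathcal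 V_2(s^{\lessdot i})\otimes\mathcal V_4(s^{\gtrdot i})\big)\subset\big((\mathcal V_1\ominus\mathcal V_3)\boxtimes(\mathcal V_2\ominus\mathcal V_4)\big)(t).$$ *)

(* Defs.v *)
From HB Require Import structures.
From mathcomp Require Import all_boot all_order all_algebra.
From mathcomp Require Import boolp reals.
From mathcomp Require Import complex.
Set Implicit Arguments.
Unset Strict Implicit.
Unset Printing Implicit Defensive.
Import GRing.Theory.

(* Positions in a word of length n are numbered 0, ..., n-1 (instead of
   1, ..., n), and a set of positions is given by its indicator function. *)

Section Restriction.
Context {T : Type}.
Implicit Types (w : seq T) (A B : pred nat).

(* restr A w is the subword w|_A *)
Definition restr A w : seq T := mask [seq A j | j <- iota 0 (size w)] w.

(* the number of elements of A smaller than i: for i in A, this is the position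
   in w|_A of the letter w(i) *)
Definition rank A (i : nat) : nat := count A (iota 0 i).

Lemma restrE x0 A w :
  restr A w = [seq nth x0 w j | j <- [seq j <- iota 0 (size w) | A j]].
Proof.
by rewrite /restr -{2}[w](mkseq_nth x0) /mkseq -map_mask -filter_mask.
Qed.

Lemma size_restr A w : size (restr A w) = rank A (size w).
Proof. by rewrite size_mask ?size_map ?size_iota// count_map. Qed.

Lemma nth_filter_rank A n i : i < n -> A i ->
  nth 0 [seq j <- iota 0 n | A j] (rank A i) = i.
Proof.
move=> lt_in Ai; rewrite -{1}(subnKC (ltnW lt_in)) iotaD filter_cat nth_cat.
rewrite size_filter ltnn subnn add0n.
by case: (n - i) (subn_gt0 i n) => [|m]; rewrite lt_in //= Ai.
Qed.

Lemma rank_lt A n i : i < n -> A i -> rank A i < rank A n.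
Proof.
move=> lt_in Ai; rewrite /rank -(subnKC lt_in) iotaD count_cat -(addn1 i) iotaD count_cat /=.
by rewrite add0n Ai -addnA -[X in X <= _]addn1 leq_add2l.
Qed.

Lemma rank_ltn A i j : A i -> A j -> (rank A i < rank A j) = (i < j).
Proof.
have H a b : A a -> a < b -> rank A a < rank A b by move=> Aa lt_ab; apply: rank_lt.
move=> Ai Aj; case: (ltngtP i j) => [ij|ji|->]; last by rewrite ltnn.
  exact: H.
by apply/negbTE; rewrite -leqNgt ltnW // H.
Qed.

Lemma rank_nth A n k : k < rank A n ->
  let p := nth 0 [seq j <- iota 0 n | A j] k in
  [/\ p < n, A p & rank A p = k].
Proof.
move=> lt_k p.
have : p \in [seq j <- iota 0 n | A j] by rewrite mem_nth ?size_filter.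
rewrite mem_filter mem_iota add0n => /andP[Ap lt_pn]; split=> //.
apply/eqP; rewrite -(@nth_uniq _ 0 [seq j <- iota 0 n | A j]) ?size_filter //.
- by rewrite nth_filter_rank.
- exact: rank_lt.
- by rewrite filter_uniq ?iota_uniq.
Qed.

Lemma nth_restr x0 A w i : i < size w -> A i ->
  nth x0 (restr A w) (rank A i) = nth x0 w i.
Proof.
move=> lt_i Ai; rewrite (restrE x0) (nth_map 0) ?nth_filter_rank //.
by rewrite size_filter; apply: rank_lt.
Qed.

Lemma eq_restr A B w : (forall j, j < size w -> A j = B j) ->
  restr A w = restr B w.
Proof.
move=> eqAB; congr mask; apply/eq_in_map => j.
by rewrite mem_iota => /andP[_]; apply: eqAB.
Qed.

Lemma restr_restr A B C w :
  (forall j, j < size w -> A j -> B (rank A j) = C j) ->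
  restr B (restr A w) = restr (predI C A) w.
Proof.
case: w => [//|x0 w']; move: (x0 :: w') => w eqBC.
rewrite [LHS]/restr size_restr (restrE x0 A) (restrE x0 (predI C A)).
rewrite filter_predI -map_mask; congr map; rewrite [RHS]filter_mask; congr mask.
apply: (@eq_from_nth _ false).
  by rewrite !size_map size_iota size_filter.
rewrite size_map size_iota => k lt_k.
rewrite (nth_map 0) ?size_iota // nth_iota // (nth_map 0) ?size_filter //.
by have [lt_p Ap rk] := rank_nth lt_k; rewrite add0n -{1}rk eqBC.
Qed.

Lemma restr_mkseq x0 A f n w : size w = rank A n ->
  (forall j, j < n -> A j -> f j = nth x0 w (rank A j)) ->
  restr A (mkseq f n) = w.
Proof.
move=> sz_w eqf; apply: (@eq_from_nth _ x0).
  by rewrite size_restr size_mkseq.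
move=> k; rewrite size_restr size_mkseq => lt_k.
have [lt_p Ap rk] := rank_nth lt_k.
rewrite -{1}rk nth_restr ?size_mkseq // nth_mkseq // eqf //.
by rewrite rk.
Qed.

End Restriction.

Lemma map_restr T U (f : T -> U) A (w : seq T) :
  map f (restr A w) = restr A (map f w).
Proof. by rewrite /restr map_mask size_map. Qed.

Lemma eq_rank A B n : (forall j, j < n -> A j = B j) -> rank A n = rank B n.
Proof.
move=> eqAB; apply: eq_in_count => j.
by rewrite mem_iota => /andP[_]; apply: eqAB.
Qed.

Inductive side := Lside | Rside.
Definition side_to_bool x := if x is Lside then true else false.
Definition bool_to_side (b : bool) := if b then Lside else Rside.
Lemma side_to_boolK : cancel side_to_bool bool_to_side. Proof. by case. Qed.
HB.instance Definition _ := Countable.copy side (can_type side_to_boolK).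

(* A translucent word, i.e. a pair of words of the same length, is encoded as the
   word t(1) ... t(n) of the pairs t(i) = (alpha_t(i), b_t(i)), where false and
   true stand for 0 and 1. *)
Definition tword : Type := seq (side * bool).
HB.instance Definition _ := Choice.on tword.

Definition l0 : side * bool := (Lside, false).

Section Words.
Implicit Types (t r s u : tword) (i j k : nat) (A : pred nat).

Definition source t : seq side := [seq x.1 | x <- t].
Definition bits t : seq bool := [seq x.2 | x <- t].
Definition zeros t : pred nat := fun i => (i < size t) && ~~ nth false (bits t) i.
Definition ones t : pred nat := fun i => (i < size t) && nth false (bits t) i.
Definition target t : seq side := restr (zeros t) (source t).
Definition composable r s : bool := source r == target s.

(* The vertical composition of r and s; tcompP below is its characterization
   among all translucent words. It is meaningful for composable r and s only. *)
Definition tcomp r s : tword :=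
  mkseq (fun j => if zeros s j then nth l0 r (rank (zeros s) j) else nth l0 s j)
    (size s).

(* necklace t i j means that i precedes j in the necklace order of t *)
Definition necklace t i j : bool :=
  match nth Lside (source t) i, nth Lside (source t) j with
  | Lside, Lside => i < j
  | Lside, Rside => true
  | Rside, Lside => false
  | Rside, Rside => j < i
  end.

Definition tbelow t i : tword := restr (fun j => necklace t j i) t.
Definition tabove t i : tword := restr (fun j => necklace t i j) t.

Lemma size_source t : size (source t) = size t.
Proof. exact: size_map. Qed.

Lemma nth_source t i : i < size t -> nth Lside (source t) i = (nth l0 t i).1.
Proof. by move=> lt_i; rewrite (nth_map l0). Qed.

Lemma zerosE t i : i < size t -> zeros t i = ~~ (nth l0 t i).2.
Proof. by move=> lt_i; rewrite /zeros lt_i (nth_map l0). Qed.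

Lemma onesE t i : i < size t -> ones t i = ~~ zeros t i.
Proof. by move=> lt_i; rewrite /ones /zeros lt_i /= negbK. Qed.

Lemma zeros_lt t i : zeros t i -> i < size t.
Proof. by case/andP. Qed.

Lemma source_restr A t : source (restr A t) = restr A (source t).
Proof. exact: map_restr. Qed.

Lemma composable_size r s : composable r s -> size r = rank (zeros s) (size s).
Proof.
move=> /eqP/(congr1 size); rewrite size_source /target size_restr.
by rewrite size_source.
Qed.

Lemma size_tcomp r s : size (tcomp r s) = size s.
Proof. exact: size_mkseq. Qed.

Lemma tcomp_zeros r s : composable r s -> restr (zeros s) (tcomp r s) = r.
Proof.
move=> /composable_size sz_r; apply: (@restr_mkseq _ l0) => // j _ -> //.
Qed.

Lemma tcomp_one r s j : j < size s -> ~~ zeros s j ->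
  nth l0 (tcomp r s) j = nth l0 s j.
Proof. by move=> lt_j /negbTE h; rewrite nth_mkseq // h. Qed.

Lemma tcomp_zero r s j : zeros s j ->
  nth l0 (tcomp r s) j = nth l0 r (rank (zeros s) j).
Proof. by move=> zj; rewrite nth_mkseq ?zj // zeros_lt. Qed.

Lemma source_tcomp r s : composable r s -> source (tcomp r s) = source s.
Proof.
move=> /[dup] crs /eqP e; apply: (@eq_from_nth _ Lside).
  by rewrite !size_source size_tcomp.
move=> j; rewrite size_source size_tcomp => lt_j.
rewrite nth_source ?size_tcomp // nth_source //.
case: (boolP (zeros s j)) => [zj|nzj]; last by rewrite tcomp_one.
rewrite tcomp_zero // -nth_source ?e.
  by rewrite /target nth_restr ?size_source // nth_source.
by rewrite (composable_size crs) rank_lt.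
Qed.

Lemma tcomp_ptP r s t : composable r s ->
  tcomp r s = t <->
  [/\ size t = size s,
      forall j, j < size s -> ~~ zeros s j -> nth l0 t j = nth l0 s j
    & restr (zeros s) t = r].
Proof.
move=> crs; split=> [<-|[sz_t ht hr]].
  split; [exact: size_tcomp | by move=> *; apply: tcomp_one | exact: tcomp_zeros].
apply: (@eq_from_nth _ l0); first by rewrite size_tcomp.
move=> j; rewrite size_tcomp => lt_j.
case: (boolP (zeros s j)) => [zj|nzj]; last by rewrite tcomp_one ?ht.
by rewrite tcomp_zero // -hr nth_restr // sz_t.
Qed.

Lemma tcompP r s t : composable r s ->
  tcomp r s = t <->
  [/\ size t = size s, restr (ones s) t = restr (ones s) s
    & restr (zeros s) t = r].
Proof.
move=> crs; apply: (iff_trans (tcomp_ptP t crs)).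
split=> -[sz_t h hr]; split=> //.
  rewrite -[t](mkseq_nth l0) sz_t; apply: (@restr_mkseq _ l0).
    by rewrite size_restr.
  move=> j lt_j oj; rewrite nth_restr // h //.
  by rewrite -onesE.
move=> j lt_j; rewrite -onesE // => oj.
by rewrite -(nth_restr _ _ oj) ?sz_t // h nth_restr.
Qed.

Lemma target_tcomp r s : composable r s -> target (tcomp r s) = target r.
Proof.
move=> crs; rewrite /target source_tcomp // (eqP crs) /target.
rewrite (@restr_restr _ _ _ (zeros (tcomp r s))) => [|j lt_j zj].
  apply: eq_restr => j; rewrite size_source => lt_j /=.
  rewrite andbC; case: (boolP (zeros s j)) => //= nzj.
  rewrite zerosE ?size_tcomp // tcomp_one // -zerosE //.
  exact: negbTE.
rewrite size_source in lt_j.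
rewrite !zerosE ?size_tcomp ?tcomp_zero //.
by rewrite (composable_size crs) rank_lt.
Qed.

Lemma tcompA a b c : composable a b -> composable b c ->
  tcomp (tcomp a b) c = tcomp a (tcomp b c).
Proof.
move=> cab cbc.
have cabc : composable (tcomp a b) c by rewrite /composable source_tcomp.
have ca_bc : composable a (tcomp b c) by rewrite /composable target_tcomp.
have zbc j : j < size c ->
    zeros (tcomp b c) j = zeros c j && zeros b (rank (zeros c) j).
  move=> lt_j; rewrite zerosE ?size_tcomp //.
  case: (boolP (zeros c j)) => zj; last by rewrite tcomp_one // -zerosE // (negbTE zj).
  by rewrite tcomp_zero // -zerosE ?(composable_size cbc) ?rank_lt.
apply/esym/tcomp_ptP => //; split; first by rewrite !size_tcomp.
  move=> j; rewrite size_tcomp => lt_j; rewrite zbc //.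
  case: (boolP (zeros c j)) => zj /= nzb; last by rewrite !tcomp_one.
  rewrite 2?(tcomp_zero _ zj) tcomp_one //.
  by rewrite (composable_size cbc) rank_lt.
transitivity (restr (zeros b) (restr (zeros c) (tcomp (tcomp a b) c))); last first.
  by rewrite tcomp_zeros // tcomp_zeros.
rewrite (@restr_restr _ _ _ (zeros (tcomp b c))).
  apply: eq_restr => j; rewrite size_tcomp => lt_j /=.
  by rewrite zbc // andbAC andbb.
by move=> j; rewrite size_tcomp => lt_j zj; rewrite zbc // zj.
Qed.

Lemma eq_necklace t u i j : source t = source u ->
  necklace t i j = necklace u i j.
Proof. by rewrite /necklace => ->. Qed.

Lemma necklace_restr A t i j : i < size t -> j < size t -> A i -> A j ->
  necklace (restr A t) (rank A i) (rank A j) = necklace t i j.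
Proof.
move=> lt_i lt_j Ai Aj; rewrite /necklace source_restr.
by rewrite !nth_restr ?size_source // !rank_ltn.
Qed.

Lemma necklace_irr t i : necklace t i i = false.
Proof. by rewrite /necklace; case: nth; rewrite ltnn. Qed.

Lemma necklace_trans t : transitive (necklace t).
Proof.
move=> j i k; rewrite /necklace; do 3 case: nth => //; first exact: ltn_trans.
by move=> h1 h2; apply: ltn_trans h1.
Qed.

Lemma necklace_total t i j : [|| i == j, necklace t i j | necklace t j i].
Proof. by rewrite /necklace; do 2 case: nth; rewrite ?orbT //; case: ltngtP. Qed.

Lemma necklace_asym t i j : necklace t i j -> necklace t j i = false.
Proof.
move=> h; apply/negbTE/negP => /(necklace_trans h).
by rewrite necklace_irr.
Qed.

Lemma zeros_restr A t i : i < size t -> A i ->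
  zeros (restr A t) (rank A i) = zeros t i.
Proof.
move=> lt_i Ai; rewrite !zerosE ?nth_restr //.
by rewrite size_restr rank_lt.
Qed.

(* The word s of the definition of R, obtained from t by replacing the letters
   before (resp. after) i for the necklace order by those of sm (resp. sp). Its
   characterization is given by source_splice, tbelow_splice, tabove_splice,
   nth_splice_mid and splice_unique below. *)
Definition splice t i (sm sp : tword) : tword :=
  mkseq (fun j => if j == i then nth l0 t i
                  else if necklace t j i
                       then nth l0 sm (rank (fun k => necklace t k i) j)
                       else nth l0 sp (rank (fun k => necklace t i k) j))
    (size t).

Section Splice.
Variables (t : tword) (i : nat) (sm sp : tword).
Hypotheses (lt_i : i < size t).
Hypotheses (sm_source : source sm = source (tbelow t i)).
Hypotheses (sp_source : source sp = source (tabove t i)).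
Let s := splice t i sm sp.

Let size_sm : size sm = rank (fun k => necklace t k i) (size t).
Proof. by rewrite -size_source sm_source size_source size_restr. Qed.
Let size_sp : size sp = rank (fun k => necklace t i k) (size t).
Proof. by rewrite -size_source sp_source size_source size_restr. Qed.

Lemma size_splice : size s = size t. Proof. exact: size_mkseq. Qed.

Lemma nth_splice_mid : nth l0 s i = nth l0 t i.
Proof. by rewrite nth_mkseq // eqxx. Qed.

Lemma nth_splice_below j : j < size t -> necklace t j i ->
  nth l0 s j = nth l0 sm (rank (fun k => necklace t k i) j).
Proof.
move=> lt_j h; rewrite nth_mkseq // h; case: eqP => // ji.
by rewrite ji necklace_irr in h.
Qed.

Lemma nth_splice_above j : j < size t -> necklace t i j ->
  nth l0 s j = nth l0 sp (rank (fun k => necklace t i k) j).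
Proof.
move=> lt_j h; rewrite nth_mkseq // (necklace_asym h); case: eqP => // ji.
by rewrite ji necklace_irr in h.
Qed.

Lemma source_splice : source s = source t.
Proof.
apply: (@eq_from_nth _ Lside); rewrite !size_source ?size_splice // => j lt_j.
rewrite nth_source ?size_splice //.
have := necklace_total t i j; case/or3P => [/eqP<-|h|h].
- by rewrite nth_splice_mid nth_source.
- rewrite nth_splice_above // -nth_source ?size_sp ?rank_lt // sp_source.
  by rewrite source_restr nth_restr ?size_source.
- rewrite nth_splice_below // -nth_source ?size_sm ?(rank_lt lt_j) // sm_source.
  by rewrite source_restr (@nth_restr _ _ (fun k => necklace t k i)) ?size_source.
Qed.

Lemma tbelow_splice : tbelow s i = sm.
Proof.
rewrite /tbelow (@eq_restr _ _ (fun j => necklace t j i)) => [|j _]; last first.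
  exact: eq_necklace source_splice.
apply: (@restr_mkseq _ l0) => // j lt_j h.
by rewrite h; case: eqP => // ji; rewrite ji necklace_irr in h.
Qed.

Lemma tabove_splice : tabove s i = sp.
Proof.
rewrite /tabove (@eq_restr _ _ (fun j => necklace t i j)) => [|j _]; last first.
  exact: eq_necklace source_splice.
apply: (@restr_mkseq _ l0) => // j lt_j h.
by rewrite (necklace_asym h); case: eqP => // ji; rewrite ji necklace_irr in h.
Qed.

Lemma splice_unique u : size u = size t -> source u = source t ->
  tbelow u i = sm -> tabove u i = sp -> nth l0 u i = nth l0 t i -> u = s.
Proof.
move=> sz_u su um up ui; apply: (@eq_from_nth _ l0); first by rewrite size_splice.
move=> j; rewrite sz_u => lt_j.
have := necklace_total t i j; case/or3P => [/eqP<-|h|h].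
- by rewrite nth_splice_mid.
- rewrite nth_splice_above // -up /tabove.
  rewrite (@eq_restr _ _ (fun k => necklace t i k)) => [|k _]; last exact: eq_necklace.
  by rewrite nth_restr // sz_u.
- rewrite nth_splice_below // -um /tbelow.
  rewrite (@eq_restr _ _ (fun k => necklace t k i)) => [|k _]; last exact: eq_necklace.
  by rewrite (@nth_restr _ _ (fun k => necklace t k i)) // sz_u.
Qed.

End Splice.

(* vsplitb t (r, s) means that r o s is defined and equal to t; hsplitb t (i, (t-, t+))
   means that b_t(i) = 0 and that t- and t+ are the subwords of t made of the
   positions before and after i for the necklace order. *)
Definition vsplitb t (p : tword * tword) : bool :=
  composable p.1 p.2 && (tcomp p.1 p.2 == t).
Definition hsplitb t (p : nat * (tword * tword)) : bool :=
  [&& zeros t p.1, p.2.1 == tbelow t p.1 & p.2.2 == tabove t p.1].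

Section InterchangeIndex.
Variables (t : tword) (i : nat) (rm sm rp sp : tword).
Hypotheses (zi : zeros t i) (vm : vsplitb (tbelow t i) (rm, sm))
  (vp : vsplitb (tabove t i) (rp, sp)).

Let s := splice t i sm sp.
Let r := restr (zeros s) t.
Let i' := rank (zeros s) i.

Let lt_i : i < size t. Proof. exact: zeros_lt. Qed.
Let cm : composable rm sm. Proof. by case/andP: vm. Qed.
Let cp : composable rp sp. Proof. by case/andP: vp. Qed.
Let em : tcomp rm sm = tbelow t i. Proof. by case/andP: vm => _ /eqP. Qed.
Let ep : tcomp rp sp = tabove t i. Proof. by case/andP: vp => _ /eqP. Qed.
Let ssm : source sm = source (tbelow t i). Proof. by rewrite -em source_tcomp. Qed.
Let ssp : source sp = source (tabove t i). Proof. by rewrite -ep source_tcomp. Qed.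
Let sz_s : size s = size t. Proof. exact: size_splice. Qed.
Let szm : size sm = size (tbelow t i). Proof. by rewrite -em size_tcomp. Qed.
Let szp : size sp = size (tabove t i). Proof. by rewrite -ep size_tcomp. Qed.

Let zs : zeros s i.
Proof. by rewrite zerosE ?sz_s // nth_splice_mid // -zerosE. Qed.

Let zsm j : j < size t -> necklace t j i ->
  zeros s j = zeros sm (rank (fun k => necklace t k i) j).
Proof.
move=> lt_j h; rewrite zerosE ?sz_s // nth_splice_below // -zerosE //.
by rewrite szm size_restr (@rank_lt (fun k => necklace t k i)).
Qed.

Let zsp j : j < size t -> necklace t i j ->
  zeros s j = zeros sp (rank (fun k => necklace t i k) j).
Proof.
move=> lt_j h; rewrite zerosE ?sz_s // nth_splice_above // -zerosE //.
by rewrite szp size_restr rank_lt.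
Qed.

Lemma interchange_vsplit : vsplitb t (r, s).
Proof.
have crs : composable r s.
  by rewrite /composable /target source_restr source_splice.
rewrite /vsplitb crs; apply/eqP/tcomp_ptP => //; split=> // j.
rewrite sz_s => lt_j nz.
have := necklace_total t i j; case/or3P => [/eqP ij|h|h].
- by rewrite -ij zs in nz.
- rewrite nth_splice_above // -(@tcomp_one rp sp) -?zsp //; last first.
    by rewrite szp size_restr rank_lt.
  by rewrite ep nth_restr.
- rewrite nth_splice_below // -(@tcomp_one rm sm) -?zsm //; last first.
    by rewrite szm size_restr (@rank_lt (fun k => necklace t k i)).
  by rewrite em (@nth_restr _ _ (fun k => necklace t k i)).
Qed.

Lemma interchange_hsplit_bot : hsplitb s (i, (sm, sp)).
Proof. by rewrite /hsplitb /= zs tbelow_splice ?tabove_splice ?eqxx. Qed.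

Lemma interchange_hsplit_top : hsplitb r (i', (rm, rp)).
Proof.
rewrite /hsplitb /= zeros_restr // zi /=; apply/andP; split; apply/eqP.
  rewrite -(tcomp_zeros cm) em.
  rewrite (@restr_restr _ _ _ (zeros s)) => [|j lt_j h]; last by rewrite zsm.
  rewrite /tbelow (@restr_restr _ _ _ (fun j => necklace t j i)).
    by apply: eq_restr => j _ /=; rewrite andbC.
  by move=> j lt_j zj; rewrite necklace_restr.
rewrite -(tcomp_zeros cp) ep.
rewrite (@restr_restr _ _ _ (zeros s)) => [|j lt_j h]; last by rewrite zsp.
rewrite /tabove (@restr_restr _ _ _ (fun j => necklace t i j)).
  by apply: eq_restr => j _ /=; rewrite andbC.
by move=> j lt_j zj; rewrite necklace_restr.
Qed.

End InterchangeIndex.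

Lemma vassoc_inner t a b c u : vsplitb t (u, c) -> vsplitb u (a, b) ->
  vsplitb (tcomp b c) (b, c).
Proof.
rewrite /vsplitb /= eqxx andbT => /andP[cuc _] /andP[cab /eqP eu].
by move: cuc; rewrite -eu /composable source_tcomp.
Qed.

Lemma vassoc_outer t a b c u : vsplitb t (u, c) -> vsplitb u (a, b) ->
  vsplitb t (a, tcomp b c).
Proof.
move=> h1 h2; have /andP[cbc _] := vassoc_inner h1 h2.
move: h1 h2; rewrite /vsplitb /= => /andP[_ /eqP<-] /andP[cab /eqP<-].
by rewrite /composable target_tcomp // -tcompA // eqxx andbT.
Qed.

Section HAssoc.
Variables (t : tword) (i j : nat) (u t1 t2 t3 : tword).
Hypotheses (h1 : hsplitb t (i, (u, t3))) (h2 : hsplitb u (j, (t1, t2))).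
(* the position in t of the letter at position j of tbelow t i *)
Definition hassoc_pos : nat :=
  nth 0 [seq x <- iota 0 (size t) | necklace t x i] j.
Let k := hassoc_pos.
Let l := rank (fun x => necklace t k x) i.

Let zi : zeros t i. Proof. by case/and3P: h1. Qed.
Let lt_i : i < size t. Proof. exact: zeros_lt. Qed.
Let eu : u = tbelow t i. Proof. by case/and3P: h1 => _ /eqP. Qed.
Let e3 : t3 = tabove t i. Proof. by case/and3P: h1 => _ _ /eqP. Qed.
Let e1 : t1 = tbelow u j. Proof. by case/and3P: h2 => _ /eqP. Qed.
Let e2 : t2 = tabove u j. Proof. by case/and3P: h2 => _ _ /eqP. Qed.
Let zj : zeros u j. Proof. by case/and3P: h2. Qed.

Let kP : [/\ k < size t, necklace t k i & rank (fun x => necklace t x i) k = j].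
Proof.
have := zeros_lt zj; rewrite eu size_restr => lt_j.
exact: rank_nth lt_j.
Qed.

Let zk : zeros t k.
Proof.
have [ltk ki kj] := kP; have := zj; rewrite eu -kj.
by rewrite (@zeros_restr (fun x => necklace t x i)).
Qed.

Lemma hassoc_outer : hsplitb t (k, (t1, tabove t k)).
Proof.
have [ltk ki kj] := kP.
rewrite /hsplitb /= zk eqxx andbT; apply/eqP.
rewrite e1 eu -kj {1}/tbelow (@restr_restr _ _ _ (fun x => necklace t x k)).
  apply: eq_restr => x _ /=; apply: andb_idr => xk.
  exact: necklace_trans xk ki.
move=> x ltx xi.
exact: (@necklace_restr (fun x => necklace t x i)).
Qed.

Lemma hassoc_inner : hsplitb (tabove t k) (l, (t2, t3)).
Proof.
have [ltk ki kj] := kP.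
rewrite /hsplitb /= zeros_restr // zi /=; apply/andP; split; apply/eqP.
  rewrite e2 eu -kj {1}/tabove (@restr_restr _ _ _ (fun x => necklace t k x)).
    rewrite /tbelow (@restr_restr _ _ _ (fun x => necklace t x i)).
      by apply: eq_restr => x _ /=; rewrite andbC.
    by move=> x ltx kx; rewrite necklace_restr.
  by move=> x ltx xi; rewrite (@necklace_restr (fun x => necklace t x i)).
rewrite e3 [RHS]/tabove (@restr_restr _ _ _ (fun x => necklace t i x)).
  apply: eq_restr => x _ /=; apply/esym/andb_idr => ix.
  exact: necklace_trans ki ix.
by move=> x ltx kx; rewrite necklace_restr.
Qed.

End HAssoc.

End Words.

Local Open Scope ring_scope.
Local Open Scope quotient_scope.

Section Tensor.
Context {K : fieldType} (U V : lmodType K).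

(* The tensor product is the quotient of the set of formal sums
   u_1 (x) v_1 + ... + u_n (x) v_n, represented as sequences of pairs, by the
   congruence generated by commutativity and bilinearity. *)
Inductive tens_eq : seq (U * V) -> seq (U * V) -> Prop :=
| tens_refl s : tens_eq s s
| tens_sym s t : tens_eq s t -> tens_eq t s
| tens_trans s t u : tens_eq s t -> tens_eq t u -> tens_eq s u
| tens_cat s s' t t' : tens_eq s s' -> tens_eq t t' -> tens_eq (s ++ t) (s' ++ t')
| tens_comm s t : tens_eq (s ++ t) (t ++ s)
| tens_addl u u' v : tens_eq [:: (u + u', v)] [:: (u, v); (u', v)]
| tens_addr u v v' : tens_eq [:: (u, v + v')] [:: (u, v); (u, v')]
| tens_scale a u v : tens_eq [:: (a *: u, v)] [:: (u, a *: v)]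
| tens_zero v : tens_eq [:: (0, v)] [::].

Definition tens_eqb : rel (seq (U * V)) := fun s t => `[< tens_eq s t >].

Fact tens_eqb_refl : reflexive tens_eqb.
Proof. by move=> s; apply/asboolP; apply: tens_refl. Qed.
Fact tens_eqb_sym : symmetric tens_eqb.
Proof. by move=> s t; apply/asboolP/asboolP; apply: tens_sym. Qed.
Fact tens_eqb_trans : transitive tens_eqb.
Proof.
by move=> t s u /asboolP h1 /asboolP h2; apply/asboolP/(tens_trans h1 h2).
Qed.
Definition tens_equiv := EquivRel tens_eqb tens_eqb_refl tens_eqb_sym tens_eqb_trans.

Definition tensor : Type := {eq_quot tens_equiv}.
HB.instance Definition _ := Choice.on tensor.

Implicit Types (s t : seq (U * V)) (x y z : tensor).

Definition tens_class s : tensor := \pi_({eq_quot tens_equiv}) s.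

Lemma tens_classP s t : tens_class s = tens_class t <-> tens_eq s t.
Proof.
rewrite /tens_class; split=> [/eqmodP/asboolP//|h].
by apply/eqmodP/asboolP.
Qed.

Definition tens_repr x : seq (U * V) := repr (x : {eq_quot tens_equiv}).

Lemma tens_reprK x : tens_class (tens_repr x) = x.
Proof. exact: reprK. Qed.

Lemma tens_repr_class s : tens_eq (tens_repr (tens_class s)) s.
Proof. by apply/tens_classP; rewrite tens_reprK. Qed.

Definition tens_add x y := tens_class (tens_repr x ++ tens_repr y).
Definition tens_scl (a : K) x := tens_class [seq (a *: p.1, p.2) | p <- tens_repr x].
Definition tens_opp x := tens_scl (-1) x.

Lemma tens_addE s t : tens_add (tens_class s) (tens_class t) = tens_class (s ++ t).
Proof. by apply/tens_classP/tens_cat; apply: tens_repr_class. Qed.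

Lemma tens_eq_scl a s t : tens_eq s t ->
  tens_eq [seq (a *: p.1, p.2) | p <- s] [seq (a *: p.1, p.2) | p <- t].
Proof.
elim=> {s t} /=.
- by move=> s; apply: tens_refl.
- by move=> s t _; apply: tens_sym.
- by move=> s t u _ h _; apply: tens_trans.
- by move=> s s' t t' _ h _ h'; rewrite !map_cat; apply: tens_cat.
- by move=> s t; rewrite !map_cat; apply: tens_comm.
- by move=> u u' v; rewrite scalerDr; apply: tens_addl.
- by move=> u v v'; apply: tens_addr.
- by move=> b u v; rewrite scalerA mulrC -scalerA; apply: tens_scale.
- by move=> v; rewrite scaler0; apply: tens_zero.
Qed.

Lemma tens_sclE a s :
  tens_scl a (tens_class s) = tens_class [seq (a *: p.1, p.2) | p <- s].
Proof. by apply/tens_classP/tens_eq_scl/tens_repr_class. Qed.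

Fact tens_addA : associative tens_add.
Proof.
move=> x y z; rewrite -[x]tens_reprK -[y]tens_reprK -[z]tens_reprK.
by rewrite !tens_addE catA.
Qed.
Fact tens_addC : commutative tens_add.
Proof.
move=> x y; rewrite -[x]tens_reprK -[y]tens_reprK !tens_addE.
by apply/tens_classP/tens_comm.
Qed.
Fact tens_add0 : left_id (tens_class [::]) tens_add.
Proof. by move=> x; rewrite -[x]tens_reprK tens_addE. Qed.

Lemma tens_eq_sclD a b s :
  tens_eq [seq ((a + b) *: p.1, p.2) | p <- s]
    ([seq (a *: p.1, p.2) | p <- s] ++ [seq (b *: p.1, p.2) | p <- s]).
Proof.
elim: s => [|[u v] s IHs] /=; first exact: tens_refl.
rewrite scalerDl; apply: tens_trans (tens_cat (tens_addl _ _ _) IHs) _.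
set p := (a *: u, v); set q := (b *: u, v).
set X := [seq _ | _ <- s]; set Y := [seq _ | _ <- s].
apply: (@tens_cat [:: p] [:: p] ([:: q] ++ X ++ Y) (X ++ [:: q] ++ Y)).
  exact: tens_refl.
by rewrite !catA; apply: tens_cat; [apply: tens_comm|apply: tens_refl].
Qed.

Lemma tens_eq_scl0 s : tens_eq [seq ((0 : K) *: p.1, p.2) | p <- s] [::].
Proof.
elim: s => [|[u v] s IHs] /=; first exact: tens_refl.
by rewrite scale0r; apply: (tens_cat (tens_zero v) IHs).
Qed.

Fact tens_scl1 : left_id 1 tens_scl.
Proof.
move=> x; rewrite -[x]tens_reprK tens_sclE; congr tens_class.
by rewrite -[RHS]map_id; apply: eq_map => -[u v] /=; rewrite scale1r.
Qed.

Fact tens_addN : left_inverse (tens_class [::]) tens_opp tens_add.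
Proof.
move=> x; rewrite /tens_opp -{2}[x]tens_scl1 -[x]tens_reprK !tens_sclE tens_addE.
apply/tens_classP; apply: tens_trans (tens_sym (tens_eq_sclD _ _ _)) _.
by rewrite addNr; apply: tens_eq_scl0.
Qed.

HB.instance Definition _ := GRing.isZmodule.Build tensor
  tens_addA tens_addC tens_add0 tens_addN.

Fact tens_sclA a b x : tens_scl a (tens_scl b x) = tens_scl (a * b) x.
Proof.
rewrite -[x]tens_reprK !tens_sclE; congr tens_class.
by rewrite -map_comp; apply: eq_map => -[u v] /=; rewrite scalerA.
Qed.
Fact tens_sclDr : right_distributive tens_scl +%R.
Proof.
move=> a x y; rewrite -[x]tens_reprK -[y]tens_reprK.
by rewrite [_ + _]tens_addE !tens_sclE map_cat [RHS]tens_addE.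
Qed.
Fact tens_sclDl x : {morph tens_scl^~ x : a b / a + b}.
Proof.
move=> a b; rewrite -[x]tens_reprK !tens_sclE [RHS]tens_addE.
by apply/tens_classP/tens_eq_sclD.
Qed.

HB.instance Definition _ := GRing.Zmodule_isLmodule.Build K tensor
  tens_sclA tens_scl1 tens_sclDr tens_sclDl.

Definition tens (u : U) (v : V) : tensor := tens_class [:: (u, v)].

Lemma tens_linearl v : linear (tens^~ v).
Proof.
move=> a u u'; rewrite /tens [a *: tens_class _]tens_sclE [RHS]tens_addE.
by apply/tens_classP/tens_addl.
Qed.
Lemma tens_linearr u : linear (tens u).
Proof.
move=> a v v'; rewrite /tens [a *: tens_class _]tens_sclE [RHS]tens_addE /=.
apply/tens_classP; apply: tens_trans (tens_addr _ _ _) _.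
apply: (tens_cat (tens_sym (tens_scale a u v))).
exact: (tens_refl [:: (u, v')]).
Qed.

Lemma tens_classE s : tens_class s = \sum_(p <- s) tens p.1 p.2.
Proof.
elim: s => [|[u v] s IHs]; first by rewrite big_nil.
by rewrite big_cons -IHs [RHS]tens_addE.
Qed.

Lemma tensor_ind (P : tensor -> Prop) :
  P 0 -> (forall x y, P x -> P y -> P (x + y)) -> (forall u v, P (tens u v)) ->
  forall x, P x.
Proof.
move=> P0 PD Pt x; rewrite -[x]tens_reprK tens_classE.
by apply: big_ind => // -[u v].
Qed.

Lemma tensor_linear_ext (W : lmodType K) (f g : {linear tensor -> W}) :
  (forall u v, f (tens u v) = g (tens u v)) -> f =1 g.
Proof.
move=> fg; apply: tensor_ind => [|x y fx fy|//]; first by rewrite !linear0.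
by rewrite !linearD fx fy.
Qed.

End Tensor.

Definition bilin {K : fieldType} {U V W : lmodType K} (f : U -> V -> W) : Prop :=
  (forall v, linear (f^~ v)) /\ (forall u, linear (f u)).

Section TensorLift.
Context {K : fieldType} {U V W : lmodType K}.
Variables (f : U -> V -> W) (bf : bilin f).

Definition tlift (bf : bilin f) (x : tensor U V) : W :=
  \sum_(p <- tens_repr x) f p.1 p.2.

Let fD1 u u' v : f (u + u') v = f u v + f u' v.
Proof. by have := bf.1 v 1 u u'; rewrite !scale1r. Qed.
Let fD2 u v v' : f u (v + v') = f u v + f u v'.
Proof. by have := bf.2 u 1 v v'; rewrite !scale1r. Qed.
Let f01 v : f 0 v = 0.
Proof. by apply: (addrI (f 0 v)); rewrite -fD1 !addr0. Qed.
Let f02 u : f u 0 = 0.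
Proof. by apply: (addrI (f u 0)); rewrite -fD2 !addr0. Qed.
Let fZ1 a u v : f (a *: u) v = a *: f u v.
Proof. by have := bf.1 v a u 0; rewrite f01 !addr0. Qed.
Let fZ2 a u v : f u (a *: v) = a *: f u v.
Proof. by have := bf.2 u a v 0; rewrite f02 !addr0. Qed.

Let sum_eq (s t : seq (U * V)) : tens_eq s t ->
  \sum_(p <- s) f p.1 p.2 = \sum_(p <- t) f p.1 p.2.
Proof.
elim=> {s t}.
- by [].
- by move=> s t _ ->.
- by move=> s t u _ -> _ ->.
- by move=> s s' t t' _ h _ h'; rewrite !big_cat /= h h'.
- by move=> s t; rewrite !big_cat /= addrC.
- by move=> u u' v; rewrite !big_cons !big_nil !addr0 fD1.
- by move=> u v v'; rewrite !big_cons !big_nil !addr0 fD2.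
- by move=> a u v; rewrite !big_cons !big_nil !addr0 fZ1 fZ2.
- by move=> v; rewrite !big_cons !big_nil addr0 f01.
Qed.

Lemma tliftE u v : tlift bf (tens u v) = f u v.
Proof. by rewrite /tlift (sum_eq (tens_repr_class _)) big_seq1. Qed.

Fact tlift_linear : linear (tlift bf).
Proof.
move=> a x y; rewrite -[x]tens_reprK -[y]tens_reprK.
rewrite [a *: tens_class _]tens_sclE [X in tlift _ X]tens_addE /tlift.
rewrite (sum_eq (tens_repr_class _)) big_cat /= big_map.
rewrite !(sum_eq (tens_repr_class _)) scaler_sumr; congr (_ + _).
by apply: eq_bigr => p _; rewrite fZ1.
Qed.
HB.instance Definition _ := GRing.isLinear.Build K (tensor U V) W _ (tlift bf)
  tlift_linear.

End TensorLift.

Section TensorMaps.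
Context {K : fieldType}.

Fact tmap_bilin (U V U' V' : lmodType K)
  (f : {linear U -> U'}) (g : {linear V -> V'}) :
  bilin (fun u v => tens (f u) (g v)).
Proof.
by split=> [v|u] a x y; rewrite linearP ?tens_linearl ?tens_linearr.
Qed.
Definition tmap (U V U' V' : lmodType K)
  (f : {linear U -> U'}) (g : {linear V -> V'}) :
  tensor U V -> tensor U' V' := tlift (tmap_bilin f g).
HB.instance Definition _ (U V U' V' : lmodType K)
  (f : {linear U -> U'}) (g : {linear V -> V'}) :=
  GRing.Linear.copy (tmap f g) (tlift (tmap_bilin f g)).

Lemma tmapE (U V U' V' : lmodType K)
  (f : {linear U -> U'}) (g : {linear V -> V'}) u v :
  tmap f g (tens u v) = tens (f u) (g v).
Proof. exact: tliftE. Qed.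

Lemma tmap_id (U V : lmodType K) : tmap (@idfun U) (@idfun V) =1 idfun.
Proof.
apply: (tensor_linear_ext (g := idfun)) => u v.
by rewrite /= tmapE.
Qed.

Lemma tmap_comp (U V W U' V' W' : lmodType K)
    (g : {linear V -> W}) (f : {linear U -> V})
    (g' : {linear V' -> W'}) (f' : {linear U' -> V'}) :
  tmap (g \o f) (g' \o f') =1 tmap g g' \o tmap f f'.
Proof.
apply: (tensor_linear_ext (g := tmap g g' \o tmap f f')) => u v.
by rewrite /= !tmapE.
Qed.

Section Associator.
Variables U V W : lmodType K.

Fact tassoc_bilin1 (w : W) : bilin (fun (u : U) (v : V) => tens u (tens v w)).
Proof.
by split=> [v|u] a x y; rewrite ?tens_linearl // tens_linearr.
Qed.
Fact tassoc_bilin2 : bilin (fun x w => tlift (tassoc_bilin1 w) x).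
Proof.
split=> [w|x] a y z; first by rewrite linearP.
move: x; apply: tensor_ind => [|x x' IH IH'|u v]; rewrite ?linear0 ?scaler0 ?addr0 //.
  by rewrite /= !linearD /= IH IH' addrACA.
by rewrite !tliftE !tens_linearr.
Qed.
Definition tassoc : tensor (tensor U V) W -> tensor U (tensor V W) :=
  tlift tassoc_bilin2.
HB.instance Definition _ := GRing.Linear.copy tassoc (tlift tassoc_bilin2).

Lemma tassocE u v w : tassoc (tens (tens u v) w) = tens u (tens v w).
Proof. by rewrite /tassoc /= !tliftE. Qed.
End Associator.

Section MiddleSwap.
Variables U1 U2 U3 U4 : lmodType K.

Fact tmid_bilin1 (c : U3) (d : U4) :
  bilin (fun (a : U1) (b : U2) => tens (tens a c) (tens b d)).
Proof.
by split=> [v|u] e x y; rewrite ?tens_linearl // tens_linearr.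
Qed.
Fact tmid_bilin2 (x : tensor U1 U2) : bilin (fun c d => tlift (tmid_bilin1 c d) x).
Proof.
split=> [d|c] e y z;
  (move: x; apply: tensor_ind => [|x x' IH IH'|a b]; rewrite ?linear0 ?scaler0 ?addr0 //;
   first by rewrite /= !linearD /= IH IH' addrACA).
- by rewrite !tliftE tens_linearr tens_linearl.
- by rewrite !tliftE !tens_linearr.
Qed.
Fact tmid_bilin3 : bilin (fun x y => tlift (tmid_bilin2 x) y).
Proof.
split=> [y|x] e z z'; last by rewrite linearP.
move: y; apply: tensor_ind => [|y y' IH IH'|c d]; rewrite ?linear0 ?scaler0 ?addr0 //.
  by rewrite /= !linearD /= IH IH' addrACA.
by rewrite !tliftE linearP.
Qed.
Definition tmid : tensor (tensor U1 U2) (tensor U3 U4) ->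
    tensor (tensor U1 U3) (tensor U2 U4) := tlift tmid_bilin3.
HB.instance Definition _ := GRing.Linear.copy tmid (tlift tmid_bilin3).

Lemma tmidE a b c d :
  tmid (tens (tens a b) (tens c d)) = tens (tens a c) (tens b d).
Proof. by rewrite /tmid /= !tliftE. Qed.
End MiddleSwap.

End TensorMaps.

Arguments tassoc {K} U V W x.
Arguments tmid {K} U1 U2 U3 U4 x.

Section DirectSum.
Context {K : fieldType} {I : choiceType} (V : I -> lmodType K).

(* direct sum: the families with finite support *)
Record dsum := DSum {
  dsum_fun :> forall i, V i;
  dsum_fin : exists s : seq I, forall i, i \notin s -> dsum_fun i = 0
}.

HB.instance Definition _ := gen_eqMixin dsum.
HB.instance Definition _ := gen_choiceMixin dsum.

Lemma dsumP (f g : dsum) : (forall i, f i = g i) -> f = g.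
Proof.
case: f g => [f pf] [g pg] /= fg.
have e : f = g by apply: functional_extensionality_dep.
by case: _ / e pg => pg; congr DSum; apply: Prop_irrelevance.
Qed.

Fact dsum0_fin : exists s : seq I, forall i, i \notin s -> (0 : V i) = 0.
Proof. by exists [::]. Qed.
Definition dsum0 : dsum := DSum dsum0_fin.

Fact dsum_add_fin (f g : dsum) :
  exists s : seq I, forall i, i \notin s -> f i + g i = 0.
Proof.
have [s hs] := dsum_fin f; have [t ht] := dsum_fin g.
exists (s ++ t) => i; rewrite mem_cat negb_or => /andP[/hs-> /ht->].
by rewrite addr0.
Qed.
Definition dsum_add f g : dsum := DSum (dsum_add_fin f g).

Fact dsum_scl_fin (a : K) (f : dsum) :
  exists s : seq I, forall i, i \notin s -> a *: f i = 0.
Proof.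
by have [s hs] := dsum_fin f; exists s => i /hs ->; rewrite scaler0.
Qed.
Definition dsum_scl a f : dsum := DSum (dsum_scl_fin a f).

Fact dsum_addA : associative dsum_add.
Proof. by move=> f g h; apply: dsumP => i /=; rewrite addrA. Qed.
Fact dsum_addC : commutative dsum_add.
Proof. by move=> f g; apply: dsumP => i /=; rewrite addrC. Qed.
Fact dsum_add0 : left_id dsum0 dsum_add.
Proof. by move=> f; apply: dsumP => i /=; rewrite add0r. Qed.
Fact dsum_addN : left_inverse dsum0 (dsum_scl (-1)) dsum_add.
Proof. by move=> f; apply: dsumP => i /=; rewrite scaleN1r addNr. Qed.
HB.instance Definition _ := GRing.isZmodule.Build dsum
  dsum_addA dsum_addC dsum_add0 dsum_addN.

Fact dsum_sclA a b f : dsum_scl a (dsum_scl b f) = dsum_scl (a * b) f.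
Proof. by apply: dsumP => i /=; rewrite scalerA. Qed.
Fact dsum_scl1 : left_id 1 dsum_scl.
Proof. by move=> f; apply: dsumP => i /=; rewrite scale1r. Qed.
Fact dsum_sclDr : right_distributive dsum_scl +%R.
Proof. by move=> a f g; apply: dsumP => i /=; rewrite scalerDr. Qed.
Fact dsum_sclDl f : {morph dsum_scl^~ f : a b / a + b}.
Proof. by move=> a b; apply: dsumP => i /=; rewrite scalerDl. Qed.
HB.instance Definition _ := GRing.Zmodule_isLmodule.Build K dsum
  dsum_sclA dsum_scl1 dsum_sclDr dsum_sclDl.

Fact dincl_fin i (v : V i) :
  exists s : seq I, forall j, j \notin s -> dfwith (fun j => 0 : V j) v j = 0.
Proof.
by exists [:: i] => j; rewrite inE => ji; rewrite dfwith_out // eq_sym.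
Qed.
Definition dincl i (v : V i) : dsum := DSum (dincl_fin v).

Fact dincl_linear i : linear (@dincl i).
Proof.
move=> a u v; apply: dsumP => j /=.
case: (eqVneq i j) => [<-|ij]; first by rewrite !dfwith_in.
by rewrite !dfwith_out // scaler0 addr0.
Qed.
HB.instance Definition _ i := GRing.isLinear.Build K (V i) dsum _ (@dincl i)
  (@dincl_linear i).

Definition dsupp (f : dsum) : seq I := undup (sval (cid (dsum_fin f))).

Lemma dsuppP (f : dsum) i : i \notin dsupp f -> f i = 0.
Proof. by rewrite mem_undup; apply: svalP (cid (dsum_fin f)) i. Qed.

Section Lift.
Context {W : lmodType K} (F : forall i, {linear V i -> W}).

Definition dlift (f : dsum) : W := \sum_(i <- dsupp f) F i (f i).

Lemma dlift_supp (f : dsum) (s : seq I) : uniq s ->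
  (forall i, i \notin s -> f i = 0) -> dlift f = \sum_(i <- s) F i (f i).
Proof.
move=> us hs; rewrite /dlift.
have drop0 (t : seq I) : \sum_(i <- t) F i (f i) =
    \sum_(i <- [seq i <- t | f i != 0]) F i (f i).
  rewrite big_filter [RHS]big_mkcond; apply: eq_bigr => i _.
  by case: eqP => // ->; rewrite linear0.
rewrite drop0 [RHS]drop0; apply/perm_big/uniq_perm.
- by rewrite filter_uniq ?undup_uniq.
- by rewrite filter_uniq.
move=> i; rewrite !mem_filter; case: eqP => //= fi.
have -> : i \in s by apply: contra_notT fi => /hs.
by apply: contra_notT fi => /dsuppP.
Qed.

Lemma dliftE i (v : V i) : dlift (dincl v) = F i v.
Proof.
rewrite (@dlift_supp _ [:: i]) ?big_seq1 //= ?dfwith_in // => j.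
by rewrite inE => ji; rewrite dfwith_out // eq_sym.
Qed.

Fact dlift_linear : linear dlift.
Proof.
move=> a f g; set s := undup (dsupp f ++ dsupp g).
have us : uniq s by apply: undup_uniq.
have hf i : i \notin s -> f i = 0.
  by rewrite mem_undup mem_cat negb_or => /andP[/dsuppP].
have hg i : i \notin s -> g i = 0.
  by rewrite mem_undup mem_cat negb_or => /andP[_ /dsuppP].
have hfg i : i \notin s -> (a *: f + g) i = 0.
  by move=> si /=; rewrite hf // hg // scaler0 addr0.
rewrite (dlift_supp us hfg) (dlift_supp us hf) (dlift_supp us hg).
rewrite scaler_sumr -big_split /=; apply: eq_bigr => i _.
by rewrite linearP.
Qed.
HB.instance Definition _ := GRing.isLinear.Build K dsum W _ dlift dlift_linear.
End Lift.

Lemma dsum_sum (f : dsum) : f = \sum_(i <- dsupp f) dincl (f i).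
Proof.
apply: dsumP => j.
have ev (s : seq I) : (\sum_(i <- s) dincl (f i) : dsum) j =
    \sum_(i <- s) (dincl (f i) : dsum) j.
  by elim/big_rec2: _ => //= i y x _ ->.
rewrite ev; case: (boolP (j \in dsupp f)) => hj; last first.
  rewrite dsuppP // big1_seq //= => i hi.
  by rewrite dfwith_out //; apply: contraNneq hj => <-.
rewrite (bigD1_seq j) ?undup_uniq //= dfwith_in big1 ?addr0 // => i ij.
by rewrite dfwith_out.
Qed.

Lemma dsum_linear_ext (W : lmodType K) (f g : {linear dsum -> W}) :
  (forall i v, f (@dincl i v) = g (@dincl i v)) -> f =1 g.
Proof.
by move=> fg x; rewrite (dsum_sum x) !linear_sum; apply: eq_bigr => i _.
Qed.

End DirectSum.

Definition dmap {K : fieldType} {I : choiceType} (V W : I -> lmodType K)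
  (F : forall i, {linear V i -> W i}) : dsum V -> dsum W :=
  dlift (fun i => @dincl K I W i \o F i).
HB.instance Definition _ (K : fieldType) (I : choiceType) (V W : I -> lmodType K)
  (F : forall i, {linear V i -> W i}) :=
  GRing.Linear.copy (dmap F) (dlift (fun i => @dincl K I W i \o F i)).

Lemma dmapE {K : fieldType} {I : choiceType} (V W : I -> lmodType K)
  (F : forall i, {linear V i -> W i}) i (v : V i) :
  dmap F (dincl v) = dincl (F i v).
Proof. exact: dliftE. Qed.

Definition tensl {K : fieldType} {U V : lmodType K} (v : V) (u : U) : tensor U V :=
  tens u v.
HB.instance Definition _ (K : fieldType) (U V : lmodType K) (v : V) :=
  GRing.isLinear.Build K U (tensor U V) _ (tensl v) (tens_linearl v).
HB.instance Definition _ (K : fieldType) (U V : lmodType K) (u : U) :=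
  GRing.isLinear.Build K V (tensor U V) _ (tens u) (tens_linearr u).

Section Distribute.
Context {K : fieldType} {I : choiceType} (X : I -> lmodType K) {Y Z : lmodType K}.

Section Left.
Variable F : forall i, {linear tensor (X i) Y -> Z}.

Fact tdistl_bilin : bilin (fun f y => dlift (fun i => F i \o tensl y) f).
Proof.
split=> [y|f] a u v; first by rewrite linearP.
rewrite /dlift scaler_sumr -big_split /=; apply: eq_bigr => i _.
by rewrite /tensl tens_linearr linearP.
Qed.
Definition tdistl : tensor (dsum X) Y -> Z := tlift tdistl_bilin.
HB.instance Definition _ := GRing.Linear.copy tdistl (tlift tdistl_bilin).

Lemma tdistlE i (x : X i) y : tdistl (tens (dincl x) y) = F i (tens x y).
Proof. by rewrite /tdistl /= tliftE dliftE. Qed.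
End Left.

Section Right.
Variable F : forall i, {linear tensor Y (X i) -> Z}.

Fact tdistr_bilin : bilin (fun y f => dlift (fun i => F i \o tens y) f).
Proof.
split=> [f|y] a u v; last by rewrite linearP.
rewrite /dlift scaler_sumr -big_split /=; apply: eq_bigr => i _.
by rewrite tens_linearl linearP.
Qed.
Definition tdistr : tensor Y (dsum X) -> Z := tlift tdistr_bilin.
HB.instance Definition _ := GRing.Linear.copy tdistr (tlift tdistr_bilin).

Lemma tdistrE i y (x : X i) : tdistr (tens y (dincl x)) = F i (tens y x).
Proof. by rewrite /tdistr /= tliftE dliftE. Qed.
End Right.

End Distribute.
(* Index types of the direct sums that define the vertical and the horizontal
   composition at t. In a horizontal splitting, the words t- and t+ are determined
   by the position i; having them as data makes the summands V(t-) (x) V'(t+) of the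
   source and the target of R the same types, without casts. *)
Definition vsplit (t : tword) : choiceType := {p | vsplitb t p}.
Definition vtop (t : tword) (p : vsplit t) : tword := (sval p).1.
Definition vbot (t : tword) (p : vsplit t) : tword := (sval p).2.

Definition hsplit (t : tword) : choiceType := {p | hsplitb t p}.
Definition hpos (t : tword) (p : hsplit t) : nat := (sval p).1.
Definition hlo (t : tword) (p : hsplit t) : tword := (sval p).2.1.
Definition hhi (t : tword) (p : hsplit t) : tword := (sval p).2.2.

Definition collection (K : fieldType) := tword -> lmodType K.

Definition mor {K : fieldType} (U V : collection K) :=
  forall t : tword, {linear U t -> V t}.

Declare Scope collection_scope.
Delimit Scope collection_scope with coll.
Bind Scope collection_scope with collection.
Declare Scope morphism_scope.
Delimit Scope morphism_scope with mor.
Bind Scope morphism_scope with mor.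

Section Collections.
Context {K : fieldType}.
Implicit Types (U V W : collection K).

Definition mor_id U : mor U U := fun t => idfun.
Definition mor_comp U V W (g : mor V W) (f : mor U V) : mor U W :=
  fun t => g t \o f t.
Definition mor_eq U V (f g : mor U V) : Prop := forall t, f t =1 g t.

Definition vcomp V V' : collection K := fun t =>
  dsum (fun p : vsplit t => tensor (V (vtop p)) (V' (vbot p))).
Definition hcomp V V' : collection K := fun t =>
  dsum (fun p : hsplit t => tensor (V (hlo p)) (V' (hhi p))).

Definition vin V V' t (p : vsplit t) :
    {linear tensor (V (vtop p)) (V' (vbot p)) -> vcomp V V' t} :=
  (@dincl K (vsplit t) (fun p => tensor (V (vtop p)) (V' (vbot p))) p :
    {linear _ -> dsum _}).
Definition hin V V' t (p : hsplit t) :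
    {linear tensor (V (hlo p)) (V' (hhi p)) -> hcomp V V' t} :=
  (@dincl K (hsplit t) (fun p => tensor (V (hlo p)) (V' (hhi p))) p :
    {linear _ -> dsum _}).

Definition vmap U V U' V' (f : mor U V) (g : mor U' V') :
    mor (vcomp U U') (vcomp V V') :=
  fun t => dmap (fun p : vsplit t => tmap (f (vtop p)) (g (vbot p))).
Definition hmap U V U' V' (f : mor U V) (g : mor U' V') :
    mor (hcomp U U') (hcomp V V') :=
  fun t => dmap (fun p : hsplit t => tmap (f (hlo p)) (g (hhi p))).

Lemma vmap_id U V : mor_eq (vmap (mor_id U) (mor_id V)) (mor_id (vcomp U V)).
Proof.
move=> t; apply: dsum_linear_ext => p x; rewrite /vmap /= dmapE; congr dincl.
exact: tmap_id.
Qed.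

Lemma vmap_comp U V W U' V' W' (g : mor V W) (f : mor U V)
    (g' : mor V' W') (f' : mor U' V') :
  mor_eq (vmap (mor_comp g f) (mor_comp g' f')) (mor_comp (vmap g g') (vmap f f')).
Proof.
move=> t; apply: dsum_linear_ext => p x; rewrite /mor_comp /vmap /= !dmapE; congr dincl.
exact: tmap_comp.
Qed.

Lemma hmap_id U V : mor_eq (hmap (mor_id U) (mor_id V)) (mor_id (hcomp U V)).
Proof.
move=> t; apply: dsum_linear_ext => p x; rewrite /hmap /= dmapE; congr dincl.
exact: tmap_id.
Qed.

Lemma hmap_comp U V W U' V' W' (g : mor V W) (f : mor U V)
    (g' : mor V' W') (f' : mor U' V') :
  mor_eq (hmap (mor_comp g f) (mor_comp g' f')) (mor_comp (hmap g g') (hmap f f')).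
Proof.
move=> t; apply: dsum_linear_ext => p x; rewrite /mor_comp /hmap /= !dmapE; congr dincl.
exact: tmap_comp.
Qed.

Section VAssoc.
Variables (t : tword) (p : vsplit t) (q : vsplit (vtop p)).
Definition vassoc_in : vsplit (tcomp (vbot q) (vbot p)) :=
  exist _ (vbot q, vbot p) (vassoc_inner (svalP p) (svalP q)).
Definition vassoc_out : vsplit t :=
  exist _ (vtop q, tcomp (vbot q) (vbot p)) (vassoc_outer (svalP p) (svalP q)).
End VAssoc.

Definition vassoc U V W : mor (vcomp (vcomp U V) W) (vcomp U (vcomp V W)) :=
  fun t => dlift (fun p : vsplit t => tdistl (fun q : vsplit (vtop p) =>
    vin U (vcomp V W) (vassoc_out q) \o tmap idfun (vin V W (vassoc_in q))
    \o tassoc (U (vtop q)) (V (vbot q)) (W (vbot p)))).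

Lemma vassocE U V W t (p : vsplit t) (q : vsplit (vtop p)) a b c :
  vassoc U V W t (vin (vcomp U V) W p (tens (vin U V q (tens a b)) c)) =
  vin U (vcomp V W) (vassoc_out q) (tens a (vin V W (vassoc_in q) (tens b c))).
Proof.
rewrite /vassoc /vin /= dliftE; apply: (etrans (tdistlE _ _ _)).
by rewrite /= tassocE tmapE.
Qed.

Section HAssoc.
Variables (t : tword) (p : hsplit t) (q : hsplit (hlo p)).
Definition hassoc_out : hsplit t :=
  let k := hassoc_pos t (hpos p) (hpos q) in
  exist _ (k, (hlo q, tabove t k)) (hassoc_outer (svalP p) (svalP q)).
Definition hassoc_in : hsplit (hhi hassoc_out) :=
  let k := hassoc_pos t (hpos p) (hpos q) in
  exist _ (rank (necklace t k) (hpos p), (hhi q, hhi p))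
    (hassoc_inner (svalP p) (svalP q)).
End HAssoc.

Definition hassoc U V W : mor (hcomp (hcomp U V) W) (hcomp U (hcomp V W)) :=
  fun t => dlift (fun p : hsplit t => tdistl (fun q : hsplit (hlo p) =>
    hin U (hcomp V W) (hassoc_out q) \o tmap idfun (hin V W (hassoc_in q))
    \o tassoc (U (hlo q)) (V (hhi q)) (W (hhi p)))).

Lemma hassocE U V W t (p : hsplit t) (q : hsplit (hlo p)) a b c :
  hassoc U V W t (hin (hcomp U V) W p (tens (hin U V q (tens a b)) c)) =
  hin U (hcomp V W) (hassoc_out q) (tens a (hin V W (hassoc_in q) (tens b c))).
Proof.
rewrite /hassoc /hin /= dliftE; apply: (etrans (tdistlE _ _ _)).
by rewrite /= tassocE tmapE.
Qed.

Section InterchangeIndices.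
Variables (t : tword) (i : hsplit t) (p : vsplit (hlo i)) (q : vsplit (hhi i)).
Let s := splice t (hpos i) (vbot p) (vbot q).
Let r := restr (zeros s) t.

Fact hsplit_zeros : zeros t (hpos i).
Proof. by have /and3P[] := svalP i. Qed.
Fact hsplit_lo : hlo i = tbelow t (hpos i).
Proof. by have /and3P[_ /eqP] := svalP i. Qed.
Fact hsplit_hi : hhi i = tabove t (hpos i).
Proof. by have /and3P[_ _ /eqP] := svalP i. Qed.
Fact interchange_lo : vsplitb (tbelow t (hpos i)) (vtop p, vbot p).
Proof. by rewrite -hsplit_lo; apply: (svalP p). Qed.
Fact interchange_hi : vsplitb (tabove t (hpos i)) (vtop q, vbot q).
Proof. by rewrite -hsplit_hi; apply: (svalP q). Qed.

Definition interchange_vert : vsplit t :=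
  exist _ (r, s) (interchange_vsplit hsplit_zeros interchange_lo interchange_hi).
Definition interchange_top : hsplit (vtop interchange_vert) :=
  exist _ (rank (zeros s) (hpos i), (vtop p, vtop q))
    (interchange_hsplit_top hsplit_zeros interchange_lo interchange_hi).
Definition interchange_bot : hsplit (vbot interchange_vert) :=
  exist _ (hpos i, (vbot p, vbot q))
    (interchange_hsplit_bot hsplit_zeros interchange_lo interchange_hi).
End InterchangeIndices.

(* The morphism R; tw_interchangeE below is its defining formula. *)
Definition tw_interchange V1 V2 V3 V4 :
    mor (hcomp (vcomp V1 V2) (vcomp V3 V4)) (vcomp (hcomp V1 V3) (hcomp V2 V4)) :=
  fun t => dlift (fun i : hsplit t =>
    tdistl (fun p : vsplit (hlo i) => tdistr (fun q : vsplit (hhi i) =>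
      vin (hcomp V1 V3) (hcomp V2 V4) (interchange_vert p q)
      \o tmap (hin V1 V3 (interchange_top p q)) (hin V2 V4 (interchange_bot p q))
      \o tmid (V1 (vtop p)) (V2 (vbot p)) (V3 (vtop q)) (V4 (vbot q))))).

Lemma tw_interchangeE V1 V2 V3 V4 t (i : hsplit t)
    (p : vsplit (hlo i)) (q : vsplit (hhi i)) a b c d :
  tw_interchange V1 V2 V3 V4 t
    (hin (vcomp V1 V2) (vcomp V3 V4) i
      (tens (vin V1 V2 p (tens a b)) (vin V3 V4 q (tens c d)))) =
  vin (hcomp V1 V3) (hcomp V2 V4) (interchange_vert p q)
    (tens (hin V1 V3 (interchange_top p q) (tens a c))
          (hin V2 V4 (interchange_bot p q) (tens b d))).
Proof.
rewrite /tw_interchange /vin /hin /= dliftE; apply: (etrans (tdistlE _ _ _)).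
by apply: (etrans (tdistrE _ _ _)); rewrite /= tmidE tmapE.
Qed.

End Collections.

Arguments mor_id {K} U t.

Notation "V ⊠ W" := (vcomp V W) (at level 40, left associativity) : collection_scope.
Notation "V ⊖ W" := (hcomp V W) (at level 40, left associativity) : collection_scope.

Notation "f ≡ g" := (mor_eq f g) (at level 70, no associativity) : morphism_scope.
Notation "g ∘ f" := (mor_comp g f) (at level 40, left associativity) : morphism_scope.
Notation "f ⊠ g" := (vmap f g) (at level 40, left associativity) : morphism_scope.
Notation "f ⊖ g" := (hmap f g) (at level 40, left associativity) : morphism_scope.

(* Main.v *)
Require Import Defs.
From HB Require Import structures.
From mathcomp Require Import all_boot all_order all_algebra.
From mathcomp Require Import boolp reals.
From mathcomp Require Import complex.
Set Implicit Arguments.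
Unset Strict Implicit.
Unset Printing Implicit Defensive.

(** The interchange and the associators are defined summand by summand, and on a
    summand they only permute or rebracket tensor factors. It is therefore enough
    to compare both sides of each identity on pure tensors, where they produce
    the same tensors.
    For naturality they visibly lie in the same summand. For the two
    associativity constraints one has to see that the two summands of the target
    agree, although they are described by differently computed words and
    positions.

    No computation with these words is needed. The innermost factors a, b, c, ...
    are the same on both sides, hence so are the words that index them, and the
    whole decomposition of t is determined by the words indexing its innermost
    factors. Indeed:
    - in a vertical decomposition t = r o s, the word s has the left-right word
      of t, and r = t|_[s]_0 is determined by s (vsplitb_source, vsplitb_top);
    - a word s with a given left-right word and a distinguished 0-position i is
      determined, together with i, by its parts before and after i for the
      necklace order (hsplitb_inj): the length of the part before i is the number
      of predecessors of i in a total order that depends on the left-right word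
      only, so it determines i, and the letters of s can then be read off.
    Applying these facts to the bottom word first and to the top word next gives
    vin_hin_hin_eq and vin_vin_hin_eq, which identify the summands occurring in
    the first and in the second constraint. *)

(** * Rigidity of the decompositions of a translucent word *)

Lemma rank_tbelow_lt t i j n : i < n -> necklace t i j ->
  rank (fun k => necklace t k i) n < rank (fun k => necklace t k j) n.
Proof.
move=> lt_in ij; rewrite /rank -!size_filter.
apply: (@uniq_leq_size _ (i :: [seq k <- iota 0 n | necklace t k i])).
  by rewrite /= mem_filter necklace_irr filter_uniq ?iota_uniq.
move=> k; rewrite inE mem_filter => /orP[/eqP->|/andP[ki kn]].
  by rewrite mem_filter ij mem_iota.
by rewrite mem_filter kn andbT (necklace_trans ki ij).
Qed.

(** The number of necklace predecessors of a position determines it, so the part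
    after the position plays no role here. *)
Lemma hsplitb_pos s1 s2 i1 i2 y z1 z2 : source s1 = source s2 ->
  hsplitb s1 (i1, (y, z1)) -> hsplitb s2 (i2, (y, z2)) -> i1 = i2.
Proof.
move=> es /and3P[/= /zeros_lt lt1 /eqP e1 _] /and3P[/= /zeros_lt lt2 /eqP e2 _].
have sz : size s1 = size s2 by rewrite -!size_source es.
have : rank (fun k => necklace s1 k i1) (size s1) =
       rank (fun k => necklace s1 k i2) (size s1).
  rewrite -size_restr -/(tbelow s1 i1) -e1 e2 size_restr sz.
  by apply: eq_rank => k _; apply: eq_necklace.
rewrite -sz in lt2.
have := necklace_total s1 i1 i2; case/or3P => [/eqP//|h|h].
  by have := rank_tbelow_lt lt1 h => /[swap] ->; rewrite ltnn.
by have := rank_tbelow_lt lt2 h => /[swap] ->; rewrite ltnn.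
Qed.

(** The part after the position has its left-right word determined as well, so that
    hsplitb_inj can be applied again to a splitting of that part. *)
Lemma source_hhi s1 s2 i1 i2 y z1 z2 : source s1 = source s2 ->
  hsplitb s1 (i1, (y, z1)) -> hsplitb s2 (i2, (y, z2)) -> source z1 = source z2.
Proof.
move=> es h1 h2; have e := hsplitb_pos es h1 h2.
case/and3P: h1 h2 => _ _ /eqP /= -> /and3P[_ _ /eqP /= ->].
rewrite !source_restr es e; apply: eq_restr => k _; exact: eq_necklace.
Qed.

Lemma hsplitb_inj s1 s2 i1 i2 y z : source s1 = source s2 ->
  hsplitb s1 (i1, (y, z)) -> hsplitb s2 (i2, (y, z)) -> s1 = s2 /\ i1 = i2.
Proof.
move=> es h1 h2; have e := hsplitb_pos es h1 h2; split=> //.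
case/and3P: h1 => /= z1 /eqP y1 /eqP w1; case/and3P: h2 => /= z2 /eqP y2 /eqP w2.
subst i2.
have sz : size s1 = size s2 by rewrite -!size_source es.
(* The letters at the distinguished position agree: their left-right components are
   read off the sources, and both bits are 0. *)
have el : nth l0 s1 i1 = nth l0 s2 i1.
  have lt1 := zeros_lt z1; have lt2 := zeros_lt z2.
  have : (nth l0 s1 i1).1 = (nth l0 s2 i1).1 by rewrite -!nth_source // es.
  move: z1 z2; rewrite !zerosE //.
  by case: (nth l0 s1 i1) (nth l0 s2 i1) => [a b] [c d] /= /negbTE -> /negbTE -> ->.
transitivity (splice s2 i1 y z).
  by apply: (splice_unique (zeros_lt z2)).
by apply/esym/(splice_unique (zeros_lt z2)).
Qed.

Lemma vsplitb_source t r s : vsplitb t (r, s) -> source s = source t.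
Proof. by case/andP=> /= crs /eqP <-; rewrite source_tcomp. Qed.

Lemma vsplitb_top t r s : vsplitb t (r, s) -> r = restr (zeros s) t.
Proof. by case/andP=> /= crs /eqP <-; rewrite tcomp_zeros. Qed.

(** * Evaluation on pure tensors *)

Section Collections.
Context {K : fieldType}.
Implicit Types (U V W : collection K).

Lemma vmapE U V U' V' (f : mor U V) (g : mor U' V') t (p : vsplit t) u u' :
  vmap f g t (vin U U' p (tens u u')) = vin V V' p (tens (f _ u) (g _ u')).
Proof. by rewrite /vmap /vin /= dmapE; congr dincl; exact: tmapE. Qed.

Lemma hmapE U V U' V' (f : mor U V) (g : mor U' V') t (p : hsplit t) u u' :
  hmap f g t (hin U U' p (tens u u')) = hin V V' p (tens (f _ u) (g _ u')).
Proof. by rewrite /hmap /hin /= dmapE; congr dincl; exact: tmapE. Qed.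

Lemma vcomp_ext U V t (Z : lmodType K) (f g : {linear vcomp U V t -> Z}) :
  (forall (p : vsplit t) u v,
     f (vin U V p (tens u v)) = g (vin U V p (tens u v))) ->
  f =1 g.
Proof.
move=> fg; apply: dsum_linear_ext => p.
exact: (tensor_linear_ext (f := f \o vin U V p) (g := g \o vin U V p) (fg p)).
Qed.

Lemma hcomp_ext U V t (Z : lmodType K) (f g : {linear hcomp U V t -> Z}) :
  (forall (p : hsplit t) u v,
     f (hin U V p (tens u v)) = g (hin U V p (tens u v))) ->
  f =1 g.
Proof.
move=> fg; apply: dsum_linear_ext => p.
exact: (tensor_linear_ext (f := f \o hin U V p) (g := g \o hin U V p) (fg p)).
Qed.

Lemma hcomp_vcomp_ext U1 U2 U3 U4 t (Z : lmodType K)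
    (f g : {linear hcomp (vcomp U1 U2) (vcomp U3 U4) t -> Z}) :
  (forall (i : hsplit t) (p : vsplit (hlo i)) (q : vsplit (hhi i)) a b c d,
     f (hin (vcomp U1 U2) (vcomp U3 U4) i
         (tens (vin U1 U2 p (tens a b)) (vin U3 U4 q (tens c d)))) =
     g (hin (vcomp U1 U2) (vcomp U3 U4) i
         (tens (vin U1 U2 p (tens a b)) (vin U3 U4 q (tens c d))))) ->
  f =1 g.
Proof.
move=> fg; apply: hcomp_ext => i u v.
set h := hin _ _ i.
(* Linearity is used in one tensor factor at a time, the other one being fixed. *)
apply: (vcomp_ext (f := f \o h \o tensl v) (g := g \o h \o tensl v)) => p a b.
apply: (vcomp_ext (f := f \o h \o tens _) (g := g \o h \o tens _)) => q c d.
exact: fg.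
Qed.

(** * Naturality *)

Lemma tw_interchange_natural V1 V2 V3 V4 W1 W2 W3 W4
    (f1 : mor V1 W1) (f2 : mor V2 W2) (f3 : mor V3 W3) (f4 : mor V4 W4) :
  (tw_interchange W1 W2 W3 W4 ∘ ((f1 ⊠ f2) ⊖ (f3 ⊠ f4)) ≡
     ((f1 ⊖ f3) ⊠ (f2 ⊖ f4)) ∘ tw_interchange V1 V2 V3 V4)%mor.
Proof.
move=> t; apply: hcomp_vcomp_ext => i p q a b c d; rewrite /mor_comp /=.
by rewrite hmapE !vmapE !tw_interchangeE vmapE !hmapE.
Qed.

(** * Comparison of nested summands *)

(** A horizontal, resp. vertical, splitting of t given by explicit words. The two
    lemmas below are stated with these, so that equal words can be substituted
    inside the types of the tensor factors. *)
Definition mk_hsplit t i u v (h : hsplitb t (i, (u, v))) : hsplit t :=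
  exist _ (i, (u, v)) h.
Definition mk_vsplit t r s (h : vsplitb t (r, s)) : vsplit t :=
  exist _ (r, s) h.

(** The element a (x) (b (x) c) of the summand of (U1 ⊖ (U2 ⊖ U3))(t) given by a
    splitting of t at i and a splitting at j of the part v of t after i. *)
Definition hin_hin U1 U2 U3 t i u v (h : hsplitb t (i, (u, v))) j v2 v3
    (h' : hsplitb v (j, (v2, v3))) (a : U1 u) (b : U2 v2) (c : U3 v3) :
    hcomp U1 (hcomp U2 U3) t :=
  hin U1 (hcomp U2 U3) (mk_hsplit h)
    (tens a (hin U2 U3 (mk_hsplit h') (tens b c))).

(** In (U1 ⊖ (U2 ⊖ U3)) ⊠ (V1 ⊖ (V2 ⊖ V3)), a summand is determined by t and by the
    words indexing the six innermost factors. *)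
Lemma vin_hin_hin_eq U1 U2 U3 V1 V2 V3 t u1 u2 u3 v1 v2 v3
    (a : U1 u1) (c : U2 u2) (e : U3 u3) (b : V1 v1) (d : V2 v2) (f : V3 v3)
    r s (h : vsplitb t (r, s)) i u j k v l
    (hi : hsplitb r (i, (u1, u))) (hj : hsplitb u (j, (u2, u3)))
    (hk : hsplitb s (k, (v1, v))) (hl : hsplitb v (l, (v2, v3)))
    r' s' (h' : vsplitb t (r', s')) i' u' j' k' v' l'
    (hi' : hsplitb r' (i', (u1, u'))) (hj' : hsplitb u' (j', (u2, u3)))
    (hk' : hsplitb s' (k', (v1, v'))) (hl' : hsplitb v' (l', (v2, v3))) :
  vin (hcomp U1 (hcomp U2 U3)) (hcomp V1 (hcomp V2 V3)) (mk_vsplit h)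
    (tens (hin_hin hi hj a c e) (hin_hin hk hl b d f)) =
  vin (hcomp U1 (hcomp U2 U3)) (hcomp V1 (hcomp V2 V3)) (mk_vsplit h')
    (tens (hin_hin hi' hj' a c e) (hin_hin hk' hl' b d f)).
Proof.
(* The bottom word is recovered first, from its innermost part outwards. Its
   left-right word is that of t, and then it determines the top word. *)
have es : source s = source s' by rewrite (vsplitb_source h) (vsplitb_source h').
have [ev el] := hsplitb_inj (source_hhi es hk hk') hl hl'; subst v' l'.
have [ess ek] := hsplitb_inj es hk hk'; subst s' k'.
have er : r = r' by rewrite (vsplitb_top h) (vsplitb_top h').
subst r'.
have [eu ej] := hsplitb_inj (source_hhi erefl hi hi') hj hj'; subst u' j'.
have [_ ei] := hsplitb_inj erefl hi hi'; subst i'.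
by rewrite (bool_irrelevance h' h) (bool_irrelevance hi' hi)
  (bool_irrelevance hj' hj) (bool_irrelevance hk' hk) (bool_irrelevance hl' hl).
Qed.

(** In (U1 ⊖ V1) ⊠ ((U2 ⊖ V2) ⊠ (U3 ⊖ V3)), a summand is determined by t and by the
    words indexing the six innermost factors. *)
Lemma vin_vin_hin_eq U1 U2 U3 V1 V2 V3 t x1 x2 y1 y2 z1 z2
    (a : U1 x1) (d : V1 x2) (b : U2 y1) (e : V2 y2) (c : U3 z1) (f : V3 z2)
    r s (h : vsplitb t (r, s)) r2 s2 (h2 : vsplitb s (r2, s2)) i j k
    (hi : hsplitb r (i, (x1, x2))) (hj : hsplitb r2 (j, (y1, y2)))
    (hk : hsplitb s2 (k, (z1, z2)))
    r' s' (h' : vsplitb t (r', s')) r2' s2' (h2' : vsplitb s' (r2', s2')) i' j' k'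
    (hi' : hsplitb r' (i', (x1, x2))) (hj' : hsplitb r2' (j', (y1, y2)))
    (hk' : hsplitb s2' (k', (z1, z2))) :
  vin (hcomp U1 V1) (vcomp (hcomp U2 V2) (hcomp U3 V3)) (mk_vsplit h)
    (tens (hin U1 V1 (mk_hsplit hi) (tens a d))
      (vin (hcomp U2 V2) (hcomp U3 V3) (mk_vsplit h2)
        (tens (hin U2 V2 (mk_hsplit hj) (tens b e))
              (hin U3 V3 (mk_hsplit hk) (tens c f))))) =
  vin (hcomp U1 V1) (vcomp (hcomp U2 V2) (hcomp U3 V3)) (mk_vsplit h')
    (tens (hin U1 V1 (mk_hsplit hi') (tens a d))
      (vin (hcomp U2 V2) (hcomp U3 V3) (mk_vsplit h2')
        (tens (hin U2 V2 (mk_hsplit hj') (tens b e))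
              (hin U3 V3 (mk_hsplit hk') (tens c f))))).
Proof.
(* The words are recovered from the bottom up: s2 has the left-right word of t,
   the source of r2 is the target of s2, s is the composition of r2 and s2, and r is
   determined by s. *)
have es2 : source s2 = source s2'.
  rewrite (vsplitb_source h2) (vsplitb_source h).
  by rewrite (vsplitb_source h2') (vsplitb_source h').
have [ess ek] := hsplitb_inj es2 hk hk'; subst s2' k'.
have er2 : source r2 = source r2'.
  by case/andP: h2 h2' => /eqP -> _ /andP[/eqP -> _].
have [err ej] := hsplitb_inj er2 hj hj'; subst r2' j'.
have es : s = s' by case/andP: h2 h2' => _ /eqP <- /andP[_ /eqP <-].
subst s'.
have er : r = r' by rewrite (vsplitb_top h) (vsplitb_top h').
subst r'.
have [_ ei] := hsplitb_inj erefl hi hi'; subst i'.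
by rewrite (bool_irrelevance h' h) (bool_irrelevance h2' h2)
  (bool_irrelevance hi' hi) (bool_irrelevance hj' hj) (bool_irrelevance hk' hk).
Qed.

(** * The associativity constraints *)

Lemma tw_interchange_hassoc (A B C D E F : collection K) :
  ((hassoc A C E ⊠ hassoc B D F)
     ∘ tw_interchange (A ⊖ C) (B ⊖ D) E F
     ∘ (tw_interchange A B C D ⊖ mor_id (E ⊠ F)) ≡
   tw_interchange A B (C ⊖ E) (D ⊖ F)
     ∘ (mor_id (A ⊠ B) ⊖ tw_interchange C D E F)
     ∘ hassoc (A ⊠ B) (C ⊠ D) (E ⊠ F))%mor.
Proof.
set L := (X in mor_eq X _); set R := (X in mor_eq _ X).
move=> t; apply: hcomp_ext => i x y.
set h := hin _ _ i.
apply: (hcomp_vcomp_ext (f := L t \o h \o tensl y) (g := R t \o h \o tensl y)).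
move=> j p q a b c d /=; set x0 := hin _ _ j _.
apply: (vcomp_ext (f := L t \o h \o tens x0) (g := R t \o h \o tens x0)).
move=> w e f; rewrite {}/L {}/R {}/h {}/x0 /mor_comp /=.
rewrite hmapE !tw_interchangeE vmapE !hassocE hmapE !tw_interchangeE.
exact: vin_hin_hin_eq.
Qed.

Lemma tw_interchange_vassoc (A B C D E F : collection K) :
  (vassoc (A ⊖ D) (B ⊖ E) (C ⊖ F)
     ∘ (tw_interchange A B D E ⊠ mor_id (C ⊖ F))
     ∘ tw_interchange (A ⊠ B) C (D ⊠ E) F ≡
   (mor_id (A ⊖ D) ⊠ tw_interchange B C E F)
     ∘ tw_interchange A (B ⊠ C) D (E ⊠ F)
     ∘ (vassoc A B C ⊖ vassoc D E F))%mor.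
Proof.
set L := (X in mor_eq X _); set R := (X in mor_eq _ X).
move=> t; apply: hcomp_vcomp_ext => i p q x c y f.
set h := hin _ _ i; set hp := vin _ _ p; set hq := vin _ _ q.
apply: (vcomp_ext
  (f := L t \o h \o tensl (hq (tens y f)) \o hp \o tensl c)
  (g := R t \o h \o tensl (hq (tens y f)) \o hp \o tensl c)) => p' a b.
apply: (vcomp_ext
  (f := L t \o h \o tens _ \o hq \o tensl f)
  (g := R t \o h \o tens _ \o hq \o tensl f)) => q' d e.
rewrite {}/L {}/R {}/h {}/hp {}/hq /mor_comp /= /tensl.
rewrite !tw_interchangeE vmapE tw_interchangeE vassocE.
rewrite hmapE !vassocE tw_interchangeE vmapE tw_interchangeE.
exact: vin_vin_hin_eq.
Qed.

End Collections.

Theorem proposition3p25 (R : realType) :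
  (forall (V1 V2 V3 V4 W1 W2 W3 W4 : collection (complex R))
      (f1 : mor V1 W1) (f2 : mor V2 W2) (f3 : mor V3 W3) (f4 : mor V4 W4),
    (tw_interchange W1 W2 W3 W4 ∘ ((f1 ⊠ f2) ⊖ (f3 ⊠ f4)) ≡
     ((f1 ⊖ f3) ⊠ (f2 ⊖ f4)) ∘ tw_interchange V1 V2 V3 V4)%mor) /\
  (forall A B C D E F : collection (complex R),
    ((hassoc A C E ⊠ hassoc B D F)
       ∘ tw_interchange (A ⊖ C) (B ⊖ D) E F
       ∘ (tw_interchange A B C D ⊖ mor_id (E ⊠ F)) ≡
     tw_interchange A B (C ⊖ E) (D ⊖ F)
       ∘ (mor_id (A ⊠ B) ⊖ tw_interchange C D E F)
       ∘ hassoc (A ⊠ B) (C ⊠ D) (E ⊠ F))%mor /\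
    (vassoc (A ⊖ D) (B ⊖ E) (C ⊖ F)
       ∘ (tw_interchange A B D E ⊠ mor_id (C ⊖ F))
       ∘ tw_interchange (A ⊠ B) C (D ⊠ E) F ≡
     (mor_id (A ⊖ D) ⊠ tw_interchange B C E F)
       ∘ tw_interchange A (B ⊠ C) D (E ⊠ F)
       ∘ (vassoc A B C ⊖ vassoc D E F))%mor).
Proof.
split=> [*|A B C D E F]; first exact: tw_interchange_natural.
split; [exact: tw_interchange_hassoc | exact: tw_interchange_vassoc].
Qed.
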